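(* Let $n>4$ be an integer and let $a,b,c\in\mathbb{C}$ with $abc\neq 0$. Let $f(x)=x^n+ax^{n-1}+bx+c$, and put $e_1=-\frac{(n-2)ab+cn}{b(n-1)}$ and $e_2=\frac{ac}{b}$. Then \begin{align*} \Delta(f)=&(-1)^{\frac{(n+2)(n-1)}{2}}n^4(n-1)^{n-3}a^{-2}b^{n-2}\\ &\cdot\Bigg[\left(\frac{(n-1)a^2}{n^2}\right)^2e_2^{n-2}+\left(\frac{(n-1)b}{n}\right)^2e_2+\frac{(n-1)b}{n}\left(c-\frac{ab}{n^2}\right)e_1\\ &\quad+\left(c-\frac{ab}{n^2}\right)^2-\left(1+(-1)^n\right)\left(\frac{(n-1)a^2}{n^2}\right)\left(c-\frac{ab}{n^2}\right)\left(\left(\frac{e_1}{2}\right)^2-e_2\right)^{\frac{n-2}{2}}\\ &\quad-\left(\frac{(n-1)a^2}{n^2}\right)\sum_{i=0}^{\lfloor\frac{n-3}{2}\rfloor}\left(2\frac{(n-1)b}{n}e_2+\left(c-\frac{ab}{n^2}\right)\frac{n-2}{n-2-2i}e_1\right)\\ &\qquad\qquad\cdot\binom{n-3}{2i}\left(\frac{e_1}{2}\right)^{n-3-2i}\left(\left(\frac{e_1}{2}\right)^2-e_2\right)^i\Bigg]. \end{align*}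
   Context: For a polynomial $f(x)=a_nx^n+\dots+a_0\in\mathbb{C}[x]$ of degree $n\geq 1$ with roots $\xi_1,\dots,\xi_n\in\mathbb{C}$ (listed with multiplicity), the discriminant is $\Delta(f)=a_n^{2n-2}\prod_{1\leq i<j\leq n}(\xi_i-\xi_j)^2$. Conventions: $z^0=1$ for all $z\in\mathbb{C}$ (including $z=0$); the term with coefficient $1+(-1)^{n}$ is zero when $n$ is odd (so the half-integer power is irrelevant in that case). *)

(* Defs.v *)
From HB Require Import structures.
From mathcomp Require Export all_boot all_order all_algebra.
From mathcomp Require Export reals.
From mathcomp Require Export complex.

Set Implicit Arguments.
Unset Strict Implicit.
Unset Printing Implicit Defensive.

Import GRing.Theory.
Local Open Scope ring_scope.

Section Discriminant.
Variable F : closedFieldType.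

(* The roots of p with multiplicity, in an unspecified order: for r := root_seq p,
   p = lead_coef p *: \prod_(z <- r) ('X - z%:P). *)
Definition root_seq (p : {poly F}) : seq F := sval (closed_field_poly_normal p).

(* Meaningful for p of degree (size p).-1 >= 1.  The product is symmetric in
   the roots, so their order does not matter. *)
Definition discriminant (p : {poly F}) : F :=
  let n := (size p).-1 in
  let xi := root_seq p in
  lead_coef p ^+ (2 * n - 2) *
  \prod_(j < size xi) \prod_(i < j) (xi`_i - xi`_j) ^+ 2.

End Discriminant.

(* Main.v *)
(* The discriminant is, up to an explicit constant, the product of the values of
   [f] at the critical points [w] of [f], and there [f(w) = g(w)] for the
   trinomial remainder [g = - A x^(n-2) + B x + C] of [f] modulo [f'].  With
   [q = x^2 - e1 x + e2] one has
     [(n x + (n-1) a) g = - A f' + (n-1) b q],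
   so that [prod_w g(w)] reduces to [prod_w q(w)], which is a multiple of
   [f'(r1) f'(r2)] for the roots [r1, r2] of [q].  Reading the same identity at
   [r1] and [r2] turns this into a multiple of [g(r1) g(r2)].  Expanding that
   product produces the power sums [r1^k + r2^k] for [k = n-2, n-3], which the
   binomial theorem expresses through [e1 / 2] and [(e1 / 2)^2 - e2].  Working
   at the critical points avoids dividing by [f(- a) = c - a b], which may
   vanish. *)
Require Import Defs.
From mathcomp Require Import all_boot all_order all_algebra.
From mathcomp Require Import reals complex.
From mathcomp Require Import zify ring.

Set Implicit Arguments.
Unset Strict Implicit.

Import GRing.Theory Num.Theory.
Local Open Scope ring_scope.

(** * Discriminants as products over roots and critical points *)

Lemma horner_prod_XsubC (F : comNzRingType) (s : seq F) (x : F) :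
  (\prod_(z <- s) ('X - z%:P)).[x] = \prod_(z <- s) (x - z).
Proof. by rewrite horner_prod; apply: eq_bigr => z _; rewrite hornerXsubC. Qed.

Lemma prod_opp_seq (F : comNzRingType) (s : seq F) (g : F -> F) :
  \prod_(z <- s) - g z = (-1) ^+ size s * \prod_(z <- s) g z.
Proof.
elim: s => [|z s IHs]; first by rewrite !big_nil mulr1.
by rewrite !big_cons IHs exprS; ring.
Qed.

Lemma prod_subC (F : comNzRingType) (s : seq F) (x : F) :
  \prod_(z <- s) (z - x) = (-1) ^+ size s * \prod_(z <- s) (x - z).
Proof.
by rewrite -(prod_opp_seq s (fun z => x - z)); apply: eq_bigr => z _; rewrite opprB.
Qed.

(** Induction on the last root [x]: a new factor [(z - x) ^+ 2] contributes one [z - x] to the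
    derivative at [z] and the other, up to sign, to the derivative at [x]. These [size s] signs are
    the increment of the binomial exponent. *)
Lemma prod_deriv_prod_XsubC (F : comNzRingType) (s : seq F) :
  \prod_(j < size s) \prod_(i < j) (s`_i - s`_j) ^+ 2 =
  (-1) ^+ 'C(size s, 2) *
  \prod_(z <- s) (\prod_(w <- s) ('X - w%:P))^`().[z].
Proof.
elim/last_ind: s => [|s x IHs]; first by rewrite big_ord0 big_nil mulr1.
rewrite size_rcons big_ord_recr /= nth_rcons ltnn eqxx.
have -> : \prod_(j < size s) \prod_(i < j)
    ((rcons s x)`_i - (rcons s x)`_j) ^+ 2 =
    \prod_(j < size s) \prod_(i < j) (s`_i - s`_j) ^+ 2.
  apply: eq_bigr => j _; apply: eq_bigr => i _.
  by rewrite !nth_rcons ltn_ord (ltn_trans (ltn_ord i) (ltn_ord j)).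
have -> : \prod_(i < size s) ((rcons s x)`_i - x) ^+ 2 =
    \prod_(z <- s) (z - x) ^+ 2.
  rewrite (big_nth 0) big_mkord; apply: eq_bigr => i _.
  by rewrite nth_rcons ltn_ord.
rewrite IHs -cats1 [\prod_(w <- s ++ _) ('X - w%:P)]big_cat /= big_seq1.
rewrite [in RHS]big_cat /= big_seq1; set p := \prod_(w <- s) ('X - w%:P).
have dpE z : (p * ('X - x%:P))^`().[z] = p^`().[z] * (z - x) + p.[z].
  by rewrite derivM derivXsubC mulr1 hornerD hornerM hornerXsubC.
have -> : \prod_(z <- s) (p * ('X - x%:P))^`().[z] =
    (\prod_(z <- s) p^`().[z]) * \prod_(z <- s) (z - x).
  rewrite -big_split /=; apply: eq_big_seq => z zs.
  by rewrite dpE horner_prod_XsubC (big_rem z zs) /= subrr mul0r addr0.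
rewrite dpE subrr mulr0 add0r horner_prod_XsubC prodrXl binS bin1 exprD.
rewrite expr2 [X in _ * (X * _) = _]prod_subC; ring.
Qed.

Lemma discriminant_prod_deriv (F : closedFieldType) (p : {poly F}) :
  p \is monic ->
  discriminant p =
  (-1) ^+ 'C((size p).-1, 2) * \prod_(z <- root_seq p) p^`().[z].
Proof.
move=> /monicP p1; rewrite /discriminant p1 expr1n mul1r.
have := svalP (closed_field_poly_normal p); rewrite -/(root_seq p) p1 scale1r.
set s := root_seq p => pE.
by rewrite pE size_prod_XsubC /= prod_deriv_prod_XsubC.
Qed.

(** Symmetry of the resultant: both sides multiply all differences of a root in [s] and a root in
    [t], with one sign per pair. *)
Lemma prod_horner_sym (F : comNzRingType) (s t : seq F) (k : F) :
  \prod_(z <- s) (k *: \prod_(w <- t) ('X - w%:P)).[z] =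
  k ^+ size s * (-1) ^+ (size s * size t) *
  \prod_(w <- t) (\prod_(z <- s) ('X - z%:P)).[w].
Proof.
under eq_bigr do rewrite hornerZ horner_prod_XsubC.
under [in RHS]eq_bigr do rewrite horner_prod_XsubC.
rewrite big_split /= big_const_seq count_predT iter_mulr_1 -mulrA; congr (_ * _).
rewrite exchange_big /=; under eq_bigr do rewrite prod_subC.
by rewrite big_split /= big_const_seq count_predT iter_mulr_1 exprM.
Qed.

Lemma deriv_monic_roots (F : numClosedFieldType) (p : {poly F}) (n : nat) :
  p \is monic -> size p = n.+2 ->
  p^`() = n.+1%:R *: \prod_(w <- root_seq p^`()) ('X - w%:P) /\
  size (root_seq p^`()) = n.
Proof.
move=> /monicP p1 sp.
have n0 : n.+1%:R != 0 :> F by rewrite pnatr_eq0.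
have cn : p^`()`_n = n.+1%:R.
  by have := p1; rewrite coef_deriv lead_coefE sp /= => ->.
(* In characteristic zero the top coefficient [n.+1%:R] survives, so the degree drops by exactly
   one. *)
have sd : size p^`() = n.+1.
  apply/eqP; rewrite eqn_leq -ltnS -sp lt_size_deriv -?size_poly_gt0 ?sp //.
  by apply: contraNltn n0 => /leq_sizeP/(_ n (leqnn n)); rewrite cn => ->.
have dE := svalP (closed_field_poly_normal p^`()).
rewrite -/(root_seq p^`()) [lead_coef _]lead_coefE sd /= cn in dE.
split=> //.
by have := congr1 (size \o val) dE; rewrite /= sd size_scale // size_prod_XsubC => -[].
Qed.

Lemma discriminant_prod_critical (F : numClosedFieldType) (p : {poly F}) (n : nat) :
  p \is monic -> size p = n.+2 ->
  discriminant p =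
  (-1) ^+ 'C(n.+1, 2) * n.+1%:R ^+ n.+1 * \prod_(w <- root_seq p^`()) p.[w].
Proof.
move=> pm sp; rewrite discriminant_prod_deriv // sp /=.
have /monicP p1 := pm.
have pE := svalP (closed_field_poly_normal p).
rewrite -/(root_seq p) p1 scale1r in pE.
have [dE st] := deriv_monic_roots pm sp.
have ss : size (root_seq p) = n.+1.
  by have := congr1 (size \o val) pE; rewrite /= sp size_prod_XsubC => -[].
rewrite -mulrA; congr (_ * _).
rewrite {1}dE prod_horner_sym -pE ss st -signr_odd.
(* The sign from the exchange has exponent [n.+1 * n], which is even. *)
by rewrite mulSn oddD oddM; case: (odd n); rewrite mulr1.
Qed.

(** * Power sums of the two roots of a quadratic *)

Lemma sum_even_odd (V : nmodType) (G : nat -> V) (m : nat) :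
  \sum_(0 <= j < 2 * m) G j = \sum_(0 <= i < m) (G (2 * i)%N + G (2 * i).+1).
Proof.
elim: m => [|m IHm]; first by rewrite !big_geq.
by rewrite mulnS !big_nat_recr //= IHm addrA.
Qed.

(** Odd powers of [d] cancel and even ones double. The sum may run past [k], since the binomials
    vanish there. *)
Lemma exprD_exprB (F : comNzRingType) (k m : nat) (u d : F) :
  (k < 2 * m)%N ->
  (u + d) ^+ k + (u - d) ^+ k =
  2%:R * \sum_(0 <= i < m) 'C(k, 2 * i)%:R * u ^+ (k - 2 * i) * (d ^+ 2) ^+ i.
Proof.
move=> km.
have expand v : (u + v) ^+ k =
    \sum_(0 <= j < 2 * m) 'C(k, j)%:R * u ^+ (k - j) * v ^+ j.
  rewrite exprDn (big_cat_nat (n := k.+1)) //= [X in _ + X]big_nat_cond.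
  rewrite [X in _ + X]big1 ?addr0 => [|j /andP[/andP[kj _] _]].
    by rewrite big_mkord; apply: eq_bigr => j _; rewrite -mulr_natl mulrA.
  by rewrite bin_small // !mul0r.
rewrite !expand -big_split /= sum_even_odd big_distrr /=.
apply: eq_bigr => i _.
by rewrite (exprS d (2 * i)) (exprS (- d)) !exprM sqrrN; ring.
Qed.

(** Rewrites the power sum of exponent [n - 2] with the binomials of exponent [n - 3]; this is the
    source of the quotient of [n - 2] by [n - 2 - 2i]. *)
Lemma bin_ratio (F : numFieldType) (k j : nat) :
  (j <= k)%N ->
  'C(k.+1, j)%:R = k.+1%:R / (k.+1 - j)%:R * 'C(k, j)%:R :> F.
Proof.
move=> jk; have nz : (k.+1 - j)%:R != 0 :> F.
  by rewrite pnatr_eq0 -lt0n subn_gt0 ltnS.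
apply: (mulfI nz); rewrite -natrM -mul_bin_down natrM.
by rewrite mulrA; congr (_ * _); field.
Qed.

(* The product is over the two roots [e1 / 2 + d] and [e1 / 2 - d] of
   [X^2 - e1 X + e2]. *)
Lemma prod_trinomial_quadratic_roots (F : numFieldType) (m : nat) (A B C e1 e2 d : F) :
  d ^+ 2 = (e1 / 2%:R) ^+ 2 - e2 ->
  let g r := - A * r ^+ m.+1 + B * r + C in
  g (e1 / 2%:R + d) * g (e1 / 2%:R - d) =
  A ^+ 2 * e2 ^+ m.+1 + B ^+ 2 * e2 + B * C * e1 + C ^+ 2
  - (1 + (-1) ^+ m.+3) * A * C
    * ((e1 / 2%:R) ^+ 2 - e2) ^+ (m.+1 %/ 2)
  - A * \sum_(0 <= i < (m %/ 2).+1)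
      (2%:R * B * e2 + C * (m.+1%:R / (m.+1 - 2 * i)%:R) * e1)
      * 'C(m, 2 * i)%:R * (e1 / 2%:R) ^+ (m - 2 * i)
      * ((e1 / 2%:R) ^+ 2 - e2) ^+ i.
Proof.
move=> dd g; set u := e1 / 2%:R.
have e1E : e1 = 2%:R * u by rewrite /u; field.
have e2E : e2 = (u + d) * (u - d).
  by rewrite mulrC -subr_sqr dd -/u; ring.
have gE : g (u + d) * g (u - d) =
    A ^+ 2 * e2 ^+ m.+1 + B ^+ 2 * e2 + B * C * e1 + C ^+ 2
    - A * C * ((u + d) ^+ m.+1 + (u - d) ^+ m.+1)
    - A * B * e2 * ((u + d) ^+ m + (u - d) ^+ m).
  by rewrite /g e1E e2E exprMn !exprS; ring.
rewrite gE -/u -dd.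
rewrite (@exprD_exprB _ m (m %/ 2).+1); last by lia.
set S := \sum_(0 <= i < _) _; set T := \sum_(0 <= i < _) _.
pose U := \sum_(0 <= i < (m %/ 2).+1)
  'C(m.+1, 2 * i)%:R * u ^+ (m.+1 - 2 * i) * (d ^+ 2) ^+ i.
have TE : T = 2%:R * B * e2 * S + 2%:R * C * U.
  rewrite /T /S /U !big_distrr /= -big_split /=.
  apply: eq_big_nat => i /andP[_ im].
  rewrite (bin_ratio _ (j := 2 * i)); last by lia.
  have -> : (m.+1 - 2 * i)%N = (m - 2 * i).+1 by lia.
  by rewrite (exprS u) e1E; ring.
(* For odd [m] the expansion has one more term than [U], namely the pure power [d ^+ m.+1], counted
   twice; for even [m] there is none. *)
have -> : (u + d) ^+ m.+1 + (u - d) ^+ m.+1 =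
    2%:R * U + (1 + (-1) ^+ m.+3) * (d ^+ 2) ^+ (m.+1 %/ 2).
  rewrite -signr_odd /= negbK.
  case: (boolP (odd m)) => om.
    rewrite (@exprD_exprB _ m.+1 (m %/ 2).+2); last by lia.
    rewrite big_nat_recr //= -/U.
    have -> : (2 * (m %/ 2).+1)%N = m.+1 by lia.
    have -> : (m.+1 %/ 2)%N = (m %/ 2).+1 by lia.
    by rewrite binn subnn; ring.
  rewrite (@exprD_exprB _ m.+1 (m %/ 2).+1); last by lia.
  by rewrite -/U expr1; ring.
by rewrite TE; ring.
Qed.

(** * The discriminant through the roots of [q] *)

Lemma discriminant_trinomial (F : numClosedFieldType) (m : nat) (a b c d : F) :
  a != 0 -> b != 0 ->
  let f : {poly F} := 'X^(m.+3) + a *: 'X^(m.+2) + b *: 'X + c%:P in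
  let N : F := m.+3%:R in
  let N1 : F := m.+2%:R in
  let e1 := - ((m.+1%:R * a * b + c * N) / (b * N1)) in
  let e2 := a * c / b in
  let g r := - (N1 * a ^+ 2 / N ^+ 2) * r ^+ m.+1 + N1 * b / N * r
             + (c - a * b / N ^+ 2) in
  d ^+ 2 = (e1 / 2%:R) ^+ 2 - e2 ->
  discriminant f =
  (-1) ^+ ('C(m.+3, 2) + m.+2) * N ^+ 4 * N1 ^+ m * a ^- 2 * b ^+ m.+1
  * (g (e1 / 2%:R + d) * g (e1 / 2%:R - d)).
Proof.
move=> a0 b0 f N N1 e1 e2 g dd.
have N0 : N != 0 by rewrite pnatr_eq0.
have N10 : N1 != 0 by rewrite pnatr_eq0.
have NE : N = N1 + 1 by rewrite /N /N1 -natr1.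
have N1E : m.+1%:R = N1 - 1 :> F by rewrite /N1 -[in RHS]natr1 addrK.
have sf : size f = m.+4.
  rewrite /f -!addrA size_polyDl size_polyXn //.
  apply: leq_ltn_trans (size_polyD _ _) _; rewrite gtn_max.
  apply/andP; split; first by rewrite size_scale // size_polyXn.
  apply: leq_ltn_trans (size_polyD _ _) _; rewrite gtn_max size_scale // size_polyX.
  by rewrite (leq_ltn_trans (size_polyC_leq1 _)).
have fm : f \is monic.
  rewrite monicE lead_coefE sf /f /= !coefD !coefZ !coefXn coefX coefC /= eqxx.
  by rewrite (gtn_eqF (ltnSn _)) /= !mulr0 !addr0.
have fE x : f.[x] = x ^+ m.+3 + a * x ^+ m.+2 + b * x + c.
  by rewrite /f !hornerE.
have dfE x : f^`().[x] = N * x ^+ m.+2 + N1 * a * x ^+ m.+1 + b.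
  rewrite /f !derivD derivC !derivZ !derivXn derivX !succnK -!scaler_nat !hornerE.
  by congr (_ + _ * _ + _); apply: mulrC.
rewrite (discriminant_prod_critical fm sf) -/N.
have [dE st] := deriv_monic_roots fm sf.
rewrite -/N in dE.
set t := root_seq f^`() in dE st *.
clearbody N N1.
pose r1 := e1 / 2%:R + d; pose r2 := e1 / 2%:R - d.
pose q x := (x - r1) * (x - r2).
have qE x : q x = x ^+ 2 - e1 * x + e2.
  have -> : q x = x ^+ 2 - e1 * x + ((e1 / 2%:R) ^+ 2 - d ^+ 2).
    by rewrite /q /r1 /r2; field.
  by rewrite dd; ring.
have f_mod_df x : f.[x] = (x / N + a / N ^+ 2) * f^`().[x] + g x.
  rewrite fE dfE /g !exprS; move: N0; rewrite NE => N0.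
  by field.
have g_eq x : (N * x + N1 * a) * g x =
    - (N1 * a ^+ 2 / N ^+ 2) * f^`().[x] + N1 * b * q x.
  rewrite dfE qE /g /e1 /e2 N1E !exprS; move: N0; rewrite NE => N0.
  by field; rewrite ?b0 ?N10 ?N0.
(* The point [- (N1 * a / N)] is the zero of the linear factor [N x + N1 a]; the values of [q] and
   [f'] there evaluate the products of that factor. *)
have q_eq : q (- (N1 * a / N)) = a ^+ 2 / N ^+ 2.
  rewrite qE /e1 /e2 N1E; move: N0; rewrite NE => N0.
  by field; rewrite ?b0 ?N10 ?N0.
have df_eq : f^`().[- (N1 * a / N)] = b.
  by rewrite dfE [_ ^+ m.+2]exprS; field.
have dprod x : \prod_(w <- t) (x - w) = f^`().[x] / N.
  by rewrite [in RHS]dE hornerZ horner_prod_XsubC; field.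
have prod_lin : \prod_(w <- t) (N * w + N1 * a) = (- N) ^+ m.+2 * (b / N).
  rewrite -df_eq -dprod -st -iter_mulr_1 -(count_predT t) -big_const_seq -big_split /=.
  by apply: eq_bigr => w _; field.
have prod_q : \prod_(w <- t) q w = f^`().[r1] * f^`().[r2] / N ^+ 2.
  rewrite /q big_split /= !prod_subC !dprod st.
  rewrite mulrACA -expr2 sqrr_sign mul1r; by field.
(* At a critical point [f] equals [g], so [g_eq] turns linear factor times [f] into [N1 * b * q]. *)
have prod_f : (- N) ^+ m.+2 * (b / N) * \prod_(w <- t) f.[w] =
    (N1 * b) ^+ m.+2 * (f^`().[r1] * f^`().[r2] / N ^+ 2).
  rewrite -prod_lin -prod_q -st -iter_mulr_1 -(count_predT t) -big_const_seq -!big_split /=.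
  apply: eq_big_seq => w wt.
  have dw0 : f^`().[w] = 0.
    apply: (mulIf (invr_neq0 N0)); rewrite -dprod (big_rem w wt) /=.
    by rewrite subrr !mul0r.
  by rewrite f_mod_df dw0 mulr0 add0r g_eq dw0 mulr0 add0r.
(* [g_eq] at [r1] and [r2], where [q] vanishes; the two linear factors multiply to [a ^+ 2] by
   [q_eq]. *)
have prod_df : (N1 * a ^+ 2 / N ^+ 2) ^+ 2 * (f^`().[r1] * f^`().[r2]) =
    a ^+ 2 * (g r1 * g r2).
  have q1 : q r1 = 0 by rewrite /q subrr mul0r.
  have q2 : q r2 = 0 by rewrite /q subrr mulr0.
  have := g_eq r1; have := g_eq r2; rewrite q1 q2 !mulr0 !addr0 => h2 h1.
  transitivity (((N * r1 + N1 * a) * g r1) * ((N * r2 + N1 * a) * g r2)).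
    by rewrite h1 h2; ring.
  have -> : a ^+ 2 = N ^+ 2 * q (- (N1 * a / N)) by rewrite q_eq; field.
  by rewrite /q; field.
have prod_df' : f^`().[r1] * f^`().[r2] =
    N ^+ 4 / (N1 ^+ 2 * a ^+ 2) * (g r1 * g r2).
  have A0 : (N1 * a ^+ 2 / N ^+ 2) ^+ 2 != 0.
    by rewrite !(mulf_neq0, expf_neq0, invr_neq0).
  by apply: (mulfI A0); rewrite prod_df; field; rewrite ?a0 ?N10 ?N0.
have L0 : (- N) ^+ m.+2 * (b / N) != 0.
  by rewrite mulf_neq0 ?expf_neq0 ?oppr_eq0 // mulf_neq0 ?invr_neq0.
(* Cancelling the product of the linear factors, nonzero because [b] is, leaves the sign
   [(-1) ^+ m.+2] of [(- N) ^+ m.+2], which explains the extra [m.+2] in the exponent. *)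
apply: (mulfI L0); rewrite [LHS]mulrCA prod_f prod_df' exprD.
have -> : (- N) ^+ m.+2 = (-1) ^+ m.+2 * N ^+ m.+2 by rewrite -exprNn.
have sq : ((-1) ^+ m.+2) ^+ 2 = 1 :> F by rewrite sqrr_sign.
transitivity (((-1) ^+ m.+2) ^+ 2 * ((-1) ^+ 'C(m.+3, 2) * N ^+ m.+3 *
   ((N1 * b) ^+ m.+2 * (N ^+ 4 / (N1 ^+ 2 * a ^+ 2) * (g r1 * g r2) / N ^+ 2)))).
  by rewrite sq mul1r.
rewrite -/r1 -/r2; move: (g r1 * g r2) ((-1) ^+ 'C(m.+3, 2)) ((-1) ^+ m.+2) => G s s'.
rewrite exprMn !exprS; move: (N ^+ m) (N1 ^+ m) (b ^+ m) => x y z.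
by field; rewrite ?a0 ?N0 ?N10.
Qed.

Theorem theorem4p1 (R : realType) (n : nat) (a b c : R[i]) :
  (4 < n)%N -> a * b * c != 0 ->
  let f : {poly R[i]} := 'X^n + a *: 'X^(n - 1) + b *: 'X + c%:P in
  let e1 : R[i] :=
    - (((n - 2)%:R * a * b + c * n%:R) / (b * (n - 1)%:R)) in
  let e2 : R[i] := a * c / b in
  discriminant f =
    (-1) ^+ ((n + 2) * (n - 1) %/ 2) * n%:R ^+ 4 * (n - 1)%:R ^+ (n - 3)
    * a ^- 2 * b ^+ (n - 2)
    * (((n - 1)%:R * a ^+ 2 / n%:R ^+ 2) ^+ 2 * e2 ^+ (n - 2)
       + ((n - 1)%:R * b / n%:R) ^+ 2 * e2
       + (n - 1)%:R * b / n%:R * (c - a * b / n%:R ^+ 2) * e1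
       + (c - a * b / n%:R ^+ 2) ^+ 2
       - (1 + (-1) ^+ n) * ((n - 1)%:R * a ^+ 2 / n%:R ^+ 2)
         * (c - a * b / n%:R ^+ 2)
         * ((e1 / 2%:R) ^+ 2 - e2) ^+ ((n - 2) %/ 2)
       - (n - 1)%:R * a ^+ 2 / n%:R ^+ 2
         * \sum_(0 <= i < ((n - 3) %/ 2).+1)
             (2%:R * ((n - 1)%:R * b / n%:R) * e2
              + (c - a * b / n%:R ^+ 2)
                * ((n - 2)%:R / (n - 2 - 2 * i)%:R) * e1)
             * 'C(n - 3, 2 * i)%:R
             * (e1 / 2%:R) ^+ (n - 3 - 2 * i)
             * ((e1 / 2%:R) ^+ 2 - e2) ^+ i).
Proof.
case: n => [|[|[|m]]] // _ abc0 f e1 e2.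
have [a0 b0] : a != 0 /\ b != 0.
  by move: abc0; rewrite !mulf_eq0 !negb_or => /andP[/andP[]].
(* A square root of a quarter of the discriminant of [q], so that the roots of [q] are [e1 / 2] plus
   or minus it. *)
have dd : sqrtC ((e1 / 2%:R) ^+ 2 - e2) ^+ 2 = (e1 / 2%:R) ^+ 2 - e2.
  exact: sqrtCK.
have n1 : (m.+3 - 1 = m.+2)%N by lia.
have n2 : (m.+3 - 2 = m.+1)%N by lia.
have n3 : (m.+3 - 3 = m)%N by lia.
have nC : ('C(m.+3, 2) + m.+2 = (m.+3 + 2) * m.+2 %/ 2)%N.
  by rewrite bin2 /=; nia.
rewrite /f /e1 /e2 n1 n2 n3 in dd *.
rewrite (discriminant_trinomial a0 b0 dd) nC; congr (_ * _).
exact: prod_trinomial_quadratic_roots dd.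
Qed.
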